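(* Suppose that $\phi$ is a KMS$_\beta$ state of $(\mathcal T(\mathbb N\rtimes\mathbb N^\times),\sigma)$ for some $\beta\ge1$. Then $\phi$ vanishes on the ideal in $\mathcal T(\mathbb N\rtimes\mathbb N^\times)$ generated by $1-ss^*$. If $\beta=1$, then $\phi$ also vanishes on the ideal generated by $\{1-\sum_{j=0}^{p-1}s^jv_pv_p^*s^{*j}:p\in\mathcal P\}$, where $\mathcal P$ is the set of primes.
   Context: $\mathbb N=\{0,1,2,\dots\}$; $\mathbb N^\times$ is the multiplicative semigroup of positive integers; $\mathbb N\rtimes\mathbb N^\times$ has product $(m,a)(n,b)=(m+an,ab)$. $\mathcal T(\mathbb N\rtimes\mathbb N^\times)$ is the $C^*$-algebra generated by the isometries $T_ye_x=e_{yx}$ on $\ell^2(\mathbb N\rtimes\mathbb N^\times)$; $s:=T_{(1,1)}$, $v_a:=T_{(0,a)}$. The dynamics $\sigma:\mathbb R\to\operatorname{Aut}\mathcal T(\mathbb N\rtimes\mathbb N^\times)$ satisfies $\sigma_t(s)=s$, $\sigma_t(v_p)=p^{it}v_p$ for $p$ prime. For $\beta\in(0,\infty)$ a state $\phi$ is KMS$_\beta$ if $\phi(dc)=\phi(c\,\sigma_{i\beta}(d))$ for all $\sigma$-analytic $c,d$ (those for which $t\mapsto\sigma_t(c)$ extends to an entire function). Ideals are closed two-sided. *)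

(* Defs.v *)
From HB Require Import structures.
From mathcomp Require Import all_boot all_order all_algebra.
From mathcomp Require Import all_classical all_reals all_analysis.
From mathcomp Require Import complex.
From mathcomp Require showcase.summability.
From mathcomp Require Import ring.

Set Implicit Arguments.
Unset Strict Implicit.
Unset Printing Implicit Defensive.

Import Order.TTheory GRing.Theory Num.Theory.
Import numFieldNormedType.Exports.

Local Open Scope classical_set_scope.
Local Open Scope ring_scope.
Local Open Scope complex_scope.

(* The topology of R[i] is carried by its alias R[i]^o. *)

Local Notation normc := Normc.normc.

Section Ell2.
Variables (R : realType) (S : choiceType).
Implicit Types (f g : S -> R[i]).

Definition sqnorm f : \bar R := \esum_(x in [set: S]) (normc (f x) ^+ 2)%:E.

Definition square_summable f : bool := `[< (sqnorm f < +oo)%E >].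

Local Lemma sqnorm_ge0 f : (0 <= sqnorm f)%E.
Proof. by apply: esum_ge0 => x _; rewrite lee_fin sqr_ge0. Qed.

Local Lemma normc_ge0 (z : R[i]) : 0 <= normc z.
Proof. by case: z => a b; rewrite sqrtr_ge0. Qed.

#[local] Hint Resolve sqnorm_ge0 normc_ge0 : core.

Local Lemma normc_sqrt (b : R) : 0 < b -> normc (Num.sqrt b)%:C ^+ 2 = b.
Proof.
move=> b0; rewrite /= expr0n addr0 sqr_sqrtr ?sqr_ge0//.
by rewrite sqr_sqrtr// ltW.
Qed.

Local Lemma sqnormZ (a : R[i]) f :
  sqnorm (a *: f) = ((normc a ^+ 2)%:E * sqnorm f)%E.
Proof.
rewrite /sqnorm; have [/eqP a0|a0] := boolP (normc a ^+ 2 == 0).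
  rewrite a0 mul0e esum1// => x _.
  by rewrite [(a *: f) x]/(a * f x) Normc.normcM exprMn a0 mul0r.
have a_gt0 : 0 < normc a ^+ 2 by rewrite lt_neqAle eq_sym a0 sqr_ge0.
have le_sq (b : R) (u v : S -> R) : 0 < b ->
    (forall x, u x = b * v x) -> (forall x, 0 <= v x) ->
    (\esum_(x in setT) (u x)%:E <= b%:E * \esum_(x in setT) (v x)%:E)%E.
  move=> b0 uv v0; apply: ge_ereal_sup => _ [F [finF FS] <-].
  rewrite (eq_fsbigr (fun x => (b%:E * (v x)%:E)%E)); last first.
    by move=> x _; rewrite uv EFinM.
  rewrite -ge0_mule_fsumr => [|x]; last by rewrite lee_fin.
  by rewrite lee_pmul2l//; apply: ereal_sup_ubound; exists F.
apply/eqP; rewrite eq_le; apply/andP; split.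
  apply: le_sq => // x; last exact: sqr_ge0.
  by rewrite [(a *: f) x]/(a * f x) Normc.normcM exprMn.
rewrite -lee_pdivlMl//; apply: le_sq; first by rewrite invr_gt0.
- by move=> x; rewrite [(a *: f) x]/(a * f x) Normc.normcM exprMn mulrA mulVf// mul1r.
- by move=> x; exact: sqr_ge0.
Qed.

Local Lemma sqnormD (t : R) f g : 0 < t ->
  (sqnorm (f + g)%R <=
    (1 + t)%R%:E * sqnorm f + (1 + t^-1)%R%:E * sqnorm g)%E.
Proof.
move=> t0.
have ti0 : 0 < t^-1 by rewrite invr_gt0.
have scal (b : R) h : 0 < b ->
    (b%:E * sqnorm h = sqnorm ((Num.sqrt b)%:C *: h))%E.
  by move=> b0; rewrite sqnormZ normc_sqrt.
rewrite (scal _ f) ?(scal _ g) ?addr_gt0// -esumD; last first.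
- by move=> x _; rewrite lee_fin sqr_ge0.
- by move=> x _; rewrite lee_fin sqr_ge0.
apply: le_esum => x _; rewrite -EFinD lee_fin.
rewrite ![(_ *: _) x]/(_ * _) !Normc.normcM !exprMn.
rewrite !normc_sqrt ?addr_gt0//.
apply: (@le_trans _ _ ((normc (f x) + normc (g x)) ^+ 2)).
  by rewrite ler_pXn2r ?nnegrE ?addr_ge0// le_normcD.
set a := normc _; set b := normc _.
rewrite -subr_ge0.
have -> : (1 + t) * a ^+ 2 + (1 + t^-1) * b ^+ 2 - (a + b) ^+ 2 =
  t^-1 * (t * a - b) ^+ 2 by field; rewrite gt_eqF.
by rewrite mulr_ge0 ?sqr_ge0 ?ltW.
Qed.

Fact square_summable_submod : submod_closed square_summable.
Proof.
have ssZ a f : square_summable f -> square_summable (a *: f).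
  move=> /asboolP fS; apply/asboolP; rewrite sqnormZ.
  by rewrite -(fineK (x := sqnorm f)) ?ge0_fin_numE// -EFinM ltry.
split=> [|a f g fS gS].
  apply/asboolP; rewrite /sqnorm esum1 ?ltry// => x _.
  by rewrite Normc.normc0 expr0n.
have /asboolP afS := ssZ a f fS; move: gS => /asboolP gS; apply/asboolP.
apply: le_lt_trans (sqnormD _ _ (@ltr01 R)) _.
rewrite -(fineK (x := sqnorm (a *: f))) ?ge0_fin_numE//.
by rewrite -(fineK (x := sqnorm g)) ?ge0_fin_numE// -!EFinM -EFinD ltry.
Qed.

HB.instance Definition _ :=
  GRing.isSubmodClosed.Build R[i] (S -> R[i]) square_summable
    square_summable_submod.

Record ell2 := Ell2 { ell2_val :> S -> R[i]; _ : square_summable ell2_val }.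

HB.instance Definition _ := [isSub for ell2_val].
HB.instance Definition _ := [Choice of ell2 by <:].
HB.instance Definition _ := [SubChoice_isSubLmodule of ell2 by <:].

Local Lemma sqnorm_fin (f : ell2) : sqnorm f \is a fin_num.
Proof. by rewrite ge0_fin_numE//; apply/asboolP; case: f. Qed.

#[local] Hint Resolve sqnorm_fin : core.

Local Lemma normE (f : ell2) : sqnorm f = (fine (sqnorm f))%:E.
Proof. by rewrite fineK. Qed.

Definition ell2_norm (f : ell2) : R[i] := (Num.sqrt (fine (sqnorm f)))%:C.

Fact ell2_norm0_eq0 (f : ell2) : ell2_norm f = 0 -> f = 0.
Proof.
move/complexI/eqP; rewrite sqrtr_eq0 => f0.
have {}f0 : (sqnorm f <= 0)%E by rewrite normE lee_fin.
apply/val_inj/funext => x; apply/Normc.eq0_normc.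
have : ((normc (f x) ^+ 2)%:E <= 0)%E.
  apply: le_trans f0; apply: esum_ge; exists [set x] => //.
  by rewrite fsbig_set1.
rewrite lee_fin => fx0; apply/eqP; rewrite -sqrf_eq0 eq_le fx0.
exact: sqr_ge0.
Qed.

Fact ell2_normZ (a : R[i]) (f : ell2) : ell2_norm (a *: f) = `|a| * ell2_norm f.
Proof.
have -> : `|a| = (normc a)%:C by [].
rewrite /ell2_norm -rmorphM; congr (_%:C).
rewrite [in LHS]sqnormZ normE -EFinM /= sqrtrM ?sqr_ge0//.
by rewrite sqrtr_sqr ger0_norm.
Qed.

Fact ell2_normD (f g : ell2) : ell2_norm (f + g) <= ell2_norm f + ell2_norm g.
Proof.
rewrite /ell2_norm -rmorphD lecR.
have [a0|a0] := eqVneq (Num.sqrt (fine (sqnorm f))) 0.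
  have -> : f = 0 by apply: ell2_norm0_eq0; rewrite /ell2_norm a0.
  by rewrite add0r lerDr sqrtr_ge0.
have [b0|b0] := eqVneq (Num.sqrt (fine (sqnorm g))) 0.
  have -> : g = 0 by apply: ell2_norm0_eq0; rewrite /ell2_norm b0.
  by rewrite addr0 lerDl sqrtr_ge0.
have sq (h : ell2) : fine (sqnorm h) = Num.sqrt (fine (sqnorm h)) ^+ 2.
  by rewrite sqr_sqrtr// fine_ge0.
have {a0} : 0 < Num.sqrt (fine (sqnorm f)) by rewrite lt_neqAle eq_sym a0 sqrtr_ge0.
have {b0} : 0 < Num.sqrt (fine (sqnorm g)) by rewrite lt_neqAle eq_sym b0 sqrtr_ge0.
move: (sq f) (sq g); set a := Num.sqrt (fine _); set b := Num.sqrt (fine (sqnorm g)).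
move=> fa gb b0 a0; have ab0 : 0 <= a + b by rewrite addr_ge0// ltW.
rewrite -[leRHS]ger0_norm// -sqrtr_sqr ler_sqrt ?sqr_ge0//.
rewrite -lee_fin -normE.
apply: le_trans (sqnormD f g (divr_gt0 b0 a0)) _.
rewrite (normE f) (normE g) fa gb -!EFinM -EFinD lee_fin.
rewrite le_eqVlt; apply/orP; left; apply/eqP; field.
by rewrite !gt_eqF.
Qed.

HB.instance Definition _ := Lmodule_isNormed.Build R[i] ell2
  ell2_normD ell2_normZ ell2_norm0_eq0.

(* The sum is the limit of the net of finite partial sums. *)
Definition dot (f g : ell2) : R[i] :=
  summability.sum (fun x => f x * (g x)^* : R[i]^o).

End Ell2.

Section BoundedOperators.
Variable R : realType.

Definition opnorm (V W : normedModType R[i]) (f : V -> W) : R :=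
  sup [set normc `|f x| | x in [set x | `|x| <= 1]].

Variable V : normedModType R[i].

Definition bounded_linear (f : V -> V) : bool :=
  `[< linear f /\ exists M : R, forall x, `|f x| <= M%:C * `|x| >].

Fact bounded_linear_submod : submod_closed bounded_linear.
Proof.
split=> [|a f g /asboolP[lf [M fM]] /asboolP[lg [N gN]]]; apply/asboolP.
  split=> [a u v|]; first by rewrite scaler0 addr0.
  by exists 0 => x; rewrite normr0 mul0r.
have fgE x : (a *: f + g) x = a *: f x + g x by [].
split=> [b u v|].
  by rewrite !fgE lf lg !scalerDr !scalerA addrACA mulrC.
exists (normc a * M + N) => x; rewrite fgE.
apply: le_trans (ler_normD _ _) _.
rewrite normrZ rmorphD rmorphM mulrDl -mulrA lerD//.
exact: ler_wpM2l.
Qed.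

HB.instance Definition _ :=
  GRing.isSubmodClosed.Build R[i] (V -> V) bounded_linear
    bounded_linear_submod.

Record bop := Bop { bop_val :> V -> V; _ : bounded_linear bop_val }.

HB.instance Definition _ := [isSub for bop_val].
HB.instance Definition _ := [Choice of bop by <:].
HB.instance Definition _ := [SubChoice_isSubLmodule of bop by <:].

Local Lemma linear_bop (f : bop) : linear f.
Proof. by case: f => f /= /asboolP[]. Qed.

Local Lemma normcE (W : normedModType R[i]) (x : W) : (normc `|x|)%:C = `|x|.
Proof. exact: normr_id. Qed.

Local Lemma opnorm_has_sup (f : bop) :
  has_sup [set normc `|f x| | x in [set x : V | `|x| <= 1]].
Proof.
split; first by exists (normc `|f 0|); exists 0 => //=; rewrite normr0.
case: f => f /= /asboolP[_ [M fM]]; exists (Num.max 0 M) => _ [x /= x1 <-].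
rewrite -lecR normcE (le_trans (fM x))//.
apply: (@le_trans _ _ ((Num.max 0 M)%:C * `|x|)).
  by rewrite ler_wpM2r// lecR le_max lexx orbT.
by rewrite ler_piMr// ler0c le_max lexx.
Qed.

Local Lemma opnorm_ge0 (f : bop) : 0 <= opnorm f.
Proof.
apply: le_trans (ub_le_sup (opnorm_has_sup f).2 _).
  2: by exists 0; rewrite //= normr0.
by rewrite -ler0c normcE.
Qed.

#[local] Hint Resolve opnorm_ge0 : core.

Fact ler_opnorm (f : bop) x : `|f x| <= (opnorm f)%:C * `|x|.
Proof.
have fZ a u : f (a *: u) = a *: f u.
  have f0 : f 0 = 0 by rewrite -[0 in LHS](subrr 0) -scaleN1r addrC linear_bop
    scaleN1r addNr.
  by rewrite -[a *: u]addr0 linear_bop f0 addr0.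
have [->|x0] := eqVneq x 0.
  by rewrite -(scale0r (0 : V)) fZ !scale0r !normr0 mulr0.
have nx : 0 < `|x| by rewrite normr_gt0.
have nV : `| `|x|^-1 | = `|x|^-1 by rewrite ger0_norm// invr_ge0.
rewrite -ler_pdivrMr// mulrC -[X in X * _]nV -normrZ -fZ -[leLHS]normcE lecR.
apply: (ub_le_sup (opnorm_has_sup f).2).
by exists (`|x|^-1 *: x) => //=; rewrite normfZV.
Qed.

Fact opnorm_le (f : V -> V) (M : R) : 0 <= M ->
  (forall x, `|f x| <= M%:C * `|x|) -> opnorm f <= M.
Proof.
move=> M0 fM; apply: ge_sup.
  by exists (normc `|f 0|); exists 0 => //=; rewrite normr0.
move=> _ [x /= x1 <-]; rewrite -lecR normcE (le_trans (fM x))//.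
by rewrite ler_piMr// ler0c.
Qed.

Fact bounded_linear_id : bounded_linear id.
Proof. by apply/asboolP; split=> //; exists 1 => x; rewrite mul1r. Qed.

Fact bounded_linear_comp (f g : bop) : bounded_linear (f \o g).
Proof.
apply/asboolP; split=> [a u v|]; first by rewrite /= !linear_bop.
exists (opnorm f * opnorm g) => x /=.
apply: le_trans (ler_opnorm f _) _; rewrite rmorphM -mulrA.
by rewrite ler_wpM2l ?ler0c// ler_opnorm.
Qed.

Definition bop_one : bop := Bop bounded_linear_id.
Definition bop_mul (f g : bop) : bop := Bop (bounded_linear_comp f g).

Local Lemma bop_mulA : associative bop_mul.
Proof. by move=> f g h; apply/val_inj/funext. Qed.
Local Lemma bop_mul1l : left_id bop_one bop_mul.
Proof. by move=> f; apply/val_inj/funext. Qed.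
Local Lemma bop_mul1r : right_id bop_one bop_mul.
Proof. by move=> f; apply/val_inj/funext. Qed.
Local Lemma bop_mulDl : left_distributive bop_mul +%R.
Proof. by move=> f g h; apply/val_inj/funext. Qed.
Local Lemma bop_mulDr : right_distributive bop_mul +%R.
Proof.
move=> f g h; apply/val_inj/funext => x.
have /= := linear_bop f 1 (g x) (h x); rewrite !scale1r; exact.
Qed.

HB.instance Definition _ := GRing.Zmodule_isPzRing.Build bop
  bop_mulA bop_mul1l bop_mul1r bop_mulDl bop_mulDr.

Definition bop_norm (f : bop) : R[i] := (opnorm f)%:C.

Local Lemma bop_normD (f g : bop) : bop_norm (f + g) <= bop_norm f + bop_norm g.
Proof.
rewrite /bop_norm -rmorphD lecR opnorm_le ?addr_ge0// => x.
apply: le_trans (ler_normD (f x) (g x)) _.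
by rewrite rmorphD mulrDl lerD// ler_opnorm.
Qed.

Local Lemma bop_normZ (a : R[i]) (f : bop) : bop_norm (a *: f) = `|a| * bop_norm f.
Proof.
have leZ (b : R[i]) (g : bop) : opnorm (b *: g) <= normc b * opnorm g.
  have b0 : 0 <= normc b by rewrite -ler0c; exact: (normr_ge0 b).
  rewrite opnorm_le ?mulr_ge0// => x.
  rewrite -[(b *: g) x]/(b *: g x) normrZ rmorphM -mulrA.
  by rewrite ler_wpM2l// ler_opnorm.
rewrite -[`|a|]/(normc a)%:C /bop_norm -rmorphM; congr (_%:C).
apply/eqP; rewrite eq_le leZ andTb.
have [->|a0] := eqVneq a 0; first by rewrite Normc.normc0 mul0r; exact: opnorm_ge0.
have na0 : 0 < normc a.
  have a_gt0 : 0 < `|a| by rewrite normr_gt0.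
  by rewrite -ltcR.
rewrite -ler_pdivlMl// -Normc.normcV.
by rewrite -[in leLHS](scalerK a0 f).
Qed.

Local Lemma bop_norm0_eq0 (f : bop) : bop_norm f = 0 -> f = 0.
Proof.
move/complexI => f0; apply/val_inj/funext => x; apply/normr0_eq0/eqP.
by rewrite eq_le normr_ge0 (le_trans (ler_opnorm f x))// f0 mul0r.
Qed.

HB.instance Definition _ := Lmodule_isNormed.Build R[i] bop
  bop_normD bop_normZ bop_norm0_eq0.

End BoundedOperators.

Section Adjoint.
Variables (R : realType) (S : choiceType).
Local Notation B := (bop (ell2 R S)).

Definition is_adjoint (a b : B) : Prop := forall f g, dot (a f) g = dot f (b g).

(* Every bounded operator on ell2 has exactly one adjoint, so the default value 0
   is never returned. *)
Definition adj (a : B) : B := xget 0 [set b | is_adjoint a b].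

Definition cstar_subalgebra (D : set B) : Prop :=
  [/\ closed D, D 0,
      forall (k : R[i]) a b, D a -> D b -> D (k *: a + b),
      forall a b, D a -> D b -> D (a * b)
    & forall a, D a -> D (adj a)].

Definition cstar_generated (X : set B) : set B := smallest cstar_subalgebra X.

End Adjoint.

Definition posnat : Type := {n : nat | (0 < n)%N}.
HB.instance Definition _ := Choice.on posnat.

Definition affsg : Type := (nat * posnat)%type.
HB.instance Definition _ := Choice.on affsg.

Fact posnat_mul_subproof (a b : posnat) : (0 < val a * val b)%N.
Proof. by rewrite muln_gt0 (valP a) (valP b). Qed.

Definition posnat_mul (a b : posnat) : posnat := Sub _ (posnat_mul_subproof a b).

Definition posnat_one : posnat := Sub 1%N isT.

(* (m, a)(n, b) = (m + a n, a b) *)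
Definition affmul (x y : affsg) : affsg :=
  ((x.1 + val x.2 * y.1)%N, posnat_mul x.2 y.2).

Fact affmul_inj x : injective (affmul x).
Proof.
move=> [n b] [n' b'] [/= /addnI/eqP + /eqP].
rewrite !eqn_pmul2l ?(valP x.2)// => /eqP-> /eqP bb'; congr (_, _).
exact/val_inj.
Qed.

Section Toeplitz.
Variable R : realType.
Local Notation H := (ell2 R affsg).

(* (T_y f)(yx) = f(x), and T_y f vanishes off the right ideal of multiples of y;
   isoT_delta below is the formula T_y e_x = e_{yx}. *)
Definition translate (y : affsg) (f : affsg -> R[i]) : affsg -> R[i] :=
  fun z => if z \in range (affmul y)
    then f ('pinv_id [set: affsg] (affmul y) z) else 0.

Local Lemma translateE y f x : translate y f (affmul y x) = f x.
Proof.
rewrite /translate ifT ?inE; last by exists x.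
by rewrite pinvKV ?inE// => u v _ _; exact: affmul_inj.
Qed.

Local Lemma sqnorm_translate y f : sqnorm (translate y f) = sqnorm f.
Proof.
rewrite [RHS](_ : _ = \esum_(x in setT)
  (Normc.normc (translate y f (affmul y x)) ^+ 2)%:E); last first.
  by apply: eq_esum => x _; rewrite translateE.
rewrite -(esum_image _ _ (fun z => (Normc.normc (translate y f z) ^+ 2)%:E)).
  rewrite esum_mkcond; apply: eq_esum => z _.
  case: ifPn => // zN; rewrite /translate ifN// Normc.normc0 expr0n//.
by move=> u v _ _; exact: affmul_inj.
Qed.

Fact square_summable_translate y (f : H) : square_summable (translate y f).
Proof. by rewrite /square_summable sqnorm_translate; case: f. Qed.

Definition translation y (f : H) : H := Ell2 (square_summable_translate y f).

Fact bounded_linear_translation y : bounded_linear (translation y).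
Proof.
apply/asboolP; split=> [a f g|].
  apply/val_inj/funext => z.
  rewrite -[LHS]/(translate y (a *: f + g : H) z).
  rewrite -[RHS]/(a * translate y f z + translate y g z) /translate.
  by case: ifP => // _; rewrite mulr0 addr0.
by exists 1 => f; rewrite mul1r /Num.norm /= /ell2_norm sqnorm_translate.
Qed.

Definition isoT (y : affsg) : bop H := Bop (bounded_linear_translation y).

Fact square_summable_delta (x : affsg) :
  square_summable (fun z => (z == x)%:R : R[i]).
Proof.
apply/asboolP; rewrite /sqnorm (esumID [set x])//; last first.
  by move=> z _; rewrite lee_fin sqr_ge0.
rewrite !setTI esum_set1 ?lee_fin ?sqr_ge0// esum1 ?adde0 ?ltry// => z zx.
case: eqP => // _.
by rewrite -[X in Normc.normc X]/(0 : R[i]) Normc.normc0 expr0n.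
Qed.

Definition delta (x : affsg) : H := Ell2 (square_summable_delta x).

Lemma isoT_delta y x : isoT y (delta x) = delta (affmul y x).
Proof.
apply/val_inj/funext => z /=.
have [[u _ <-]|zN] := pselect (range (affmul y) z).
  by rewrite translateE (inj_eq (@affmul_inj y)).
rewrite /translate ifN ?notin_setE//.
by case: eqP zN => [->|//] []; exists x.
Qed.

Definition affone : affsg := (0%N, posnat_one).

Fact isoT1 : isoT affone = 1.
Proof.
apply/val_inj/funext => f; apply/val_inj/funext => x /=.
have xE : affmul affone x = x.
  case: x => m a; rewrite /affmul /= mul1n add0n; congr (_, _).
  by apply: val_inj; rewrite /= mul1n.
by rewrite -{1}xE translateE.
Qed.

Definition in_toeplitz (a : bop H) : bool :=
  `[< cstar_generated (range isoT) a >].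

Local Lemma in_toeplitzP a : reflect (cstar_generated (range isoT) a) (in_toeplitz a).
Proof. exact: asboolP. Qed.

Fact in_toeplitz_iso y : in_toeplitz (isoT y).
Proof. by apply/in_toeplitzP; apply: sub_gen_smallest; exists y. Qed.

Fact in_toeplitz_submod : submod_closed in_toeplitz.
Proof.
split=> [|k a b /in_toeplitzP aT /in_toeplitzP bT]; apply/in_toeplitzP => D [].
  by move=> [].
by move=> HD XD; case: (HD) => _ _ + _ _; apply; [exact: aT|exact: bT].
Qed.

Fact in_toeplitz_subring : subring_closed in_toeplitz.
Proof.
split=> [|a b aT bT|a b /in_toeplitzP aT /in_toeplitzP bT].
- by rewrite -isoT1; exact: in_toeplitz_iso.
- by rewrite addrC -scaleN1r; exact: in_toeplitz_submod.2.
apply/in_toeplitzP => D [HD XD].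
by case: (HD) => _ _ _ + _; apply; [exact: aT|exact: bT].
Qed.

Fact in_toeplitz_adj a : in_toeplitz a -> in_toeplitz (adj a).
Proof.
move=> /in_toeplitzP aT; apply/in_toeplitzP => D [HD XD].
by case: (HD) => _ _ _ _; apply; exact: aT.
Qed.

HB.instance Definition _ :=
  GRing.isSubringClosed.Build (bop H) in_toeplitz in_toeplitz_subring.
HB.instance Definition _ :=
  GRing.isSubmodClosed.Build R[i] (bop H) in_toeplitz in_toeplitz_submod.

Record toeplitz :=
  Toeplitz { toeplitz_val : bop H; _ : in_toeplitz toeplitz_val }.

HB.instance Definition _ := [isSub for toeplitz_val].
HB.instance Definition _ := [Choice of toeplitz by <:].
HB.instance Definition _ := [SubChoice_isSubLmodule of toeplitz by <:].
HB.instance Definition _ :=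
  GRing.SubZmodule_isSubPzRing.Build (bop H) in_toeplitz toeplitz
    in_toeplitz_subring.

Definition toeplitz_norm (a : toeplitz) : R[i] := `|val a|.

Local Lemma toeplitz_normD a b :
  toeplitz_norm (a + b) <= toeplitz_norm a + toeplitz_norm b.
Proof. exact: ler_normD. Qed.
Local Lemma toeplitz_normZ (k : R[i]) a :
  toeplitz_norm (k *: a) = `|k| * toeplitz_norm a.
Proof. exact: normrZ. Qed.
Local Lemma toeplitz_norm0_eq0 a : toeplitz_norm a = 0 -> a = 0.
Proof. by move/normr0_eq0 => a0; exact: val_inj. Qed.

HB.instance Definition _ := Lmodule_isNormed.Build R[i] toeplitz
  toeplitz_normD toeplitz_normZ toeplitz_norm0_eq0.

Definition star (a : toeplitz) : toeplitz :=
  Toeplitz (in_toeplitz_adj (valP a)).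

Definition Tgen (y : affsg) : toeplitz := Toeplitz (in_toeplitz_iso y).

Definition gen_s : toeplitz := Tgen (1%N, posnat_one).
Definition gen_v (a : posnat) : toeplitz := Tgen (0%N, a).

Definition star_automorphism (f : toeplitz -> toeplitz) : Prop :=
  [/\ linear f, {morph f : a b / a * b}, {morph f : a / star a}
    & bijective f].

(* n^{it} *)
Definition nat_powit (n : nat) (t : R) : R[i] :=
  cos (t * ln n%:R) +i* sin (t * ln n%:R).

(* The last two clauses determine sigma, since the elements s and v_p with p
   prime generate the Toeplitz algebra. *)
Definition is_dynamics (sigma : R -> toeplitz -> toeplitz) : Prop :=
  [/\ (forall t, star_automorphism (sigma t)),
      (forall t u a, sigma (t + u) a = sigma t (sigma u a)),
      (forall a, continuous (sigma^~ a)),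
      (forall t, sigma t gen_s = gen_s)
    & (forall t (p : posnat), prime (val p) ->
        sigma t (gen_v p) = nat_powit (val p) t *: gen_v p)].

(* derivable is taken over the field R[i]: this is complex differentiability. *)
Definition entire (F : R[i]^o -> toeplitz) : Prop :=
  forall z, derivable F z 1.

Definition entire_extension (sigma : R -> toeplitz -> toeplitz) (a : toeplitz)
    (F : R[i]^o -> toeplitz) : Prop :=
  entire F /\ forall t : R, F t%:C = sigma t a.

Definition analytic (sigma : R -> toeplitz -> toeplitz) (a : toeplitz) : Prop :=
  exists F, entire_extension sigma a F.

(* As sup S = 0 for S unbounded, opnorm phi = 1 includes the continuity of phi. *)
Definition is_state (phi : toeplitz -> R[i]^o) : Prop :=
  [/\ linear phi, (forall a, 0 <= phi (star a * a)) & opnorm phi = 1].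

(* The extension F of the orbit of d is unique, and F (i * beta) is
   sigma_{i beta}(d). *)
Definition is_KMS (sigma : R -> toeplitz -> toeplitz) (beta : R)
    (phi : toeplitz -> R[i]^o) : Prop :=
  is_state phi /\
  forall c d F, analytic sigma c -> entire_extension sigma d F ->
    phi (d * c) = phi (c * F (0 +i* beta)).

Definition closed_ideal (I : set toeplitz) : Prop :=
  [/\ closed I, I 0,
      forall (k : R[i]) a b, I a -> I b -> I (k *: a + b),
      forall a b, I b -> I (a * b)
    & forall a b, I b -> I (b * a)].

Definition ideal_generated (X : set toeplitz) : set toeplitz :=
  smallest closed_ideal X.

Definition vanishes_on (phi : toeplitz -> R[i]^o) (I : set toeplitz) : Prop :=
  forall a, I a -> phi a = 0.

Definition s_defect : toeplitz := 1 - gen_s * star gen_s.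

Definition v_defect (p : posnat) : toeplitz :=
  1 - \sum_(j < val p)
        gen_s ^+ j * gen_v p * star (gen_v p) * star gen_s ^+ j.

End Toeplitz.

(* Main.v *)
Require Import Defs.
From mathcomp Require Import all_boot all_order all_algebra.
From mathcomp Require Import all_classical all_reals all_analysis.
From mathcomp Require Import complex.
From mathcomp Require Import ring lra.
From mathcomp Require Import finmap.

(* Let q be one of the two kinds of generators: q = 1 - sum_i T_i T_i^* for
   finitely many isometries T_i = T_{(m_i, a_i)} with pairwise orthogonal ranges,
   so q is a projection fixed by sigma. As sigma_t T_i = a_i^{it} T_i, the KMS
   condition gives phi (T_i T_i^* ) = a_i^{-beta} phi (T_i^* T_i) = a_i^{-beta} phi 1,
   hence phi q = (1 - sum_i a_i^{-beta}) phi 1 = 0 in both cases. Then phi (x q) = 0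
   for all x by Cauchy-Schwarz, and phi (x q y) is a multiple of phi (y x q), hence
   zero, when x and y are eigenvectors of sigma. These span a dense *-algebra. *)

Import Order.TTheory GRing.Theory Num.Theory.
Import numFieldNormedType.Exports.
Local Open Scope classical_set_scope.
Local Open Scope complex_scope.
Local Open Scope ring_scope.
Set Implicit Arguments.
Unset Strict Implicit.
Unset Printing Implicit Defensive.

(** * The inner product of l^2 *)

(** Two definitions shape the proof. [adj] is a choice operator with default 0, so the rules for
    [star] are usable only where an adjoint has been exhibited. Each T_y therefore receives an
    explicit adjoint, positivity and the KMS condition are applied to eigenvectors and their finite
    sums, and the bound [|phi a| <= |a|] carries the result to the whole algebra. Secondly, [is_KMS]
    speaks of entire extensions of orbits, so every eigenvector a of frequency l comes with an
    explicit one, exp(i l z) a; the estimates on the complex exponential serve to differentiate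
    it. *)

#[local] Instance totally_proper (S : choiceType) :
  ProperFilter (@summability.totally S) := summability.totally_filter.

Section HasSum.
Variables (S : choiceType) (K : numFieldType) (V : normedModType K).
Implicit Types (u v : S -> V).

(** [summability.sum] is a limit operator, meaningful only for convergent nets. As a relation,
    convergence can be added and scaled before any value is read off. *)
Definition has_sum u (l : V) : Prop :=
  summability.partial_sum u @ summability.totally --> l.

Lemma has_sum_eq u l : has_sum u l -> summability.sum u = l.
Proof. by move=> ul; apply: cvg_lim ul; exact: norm_hausdorff. Qed.

Lemma has_sumD u v l m : has_sum u l -> has_sum v m -> has_sum (u \+ v) (l + m).
Proof.
move=> ul vm; rewrite /has_sum.
rewrite (_ : summability.partial_sum _ =
  summability.partial_sum u \+ summability.partial_sum v).
  exact: cvgD.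
by apply/funext => A; rewrite /summability.partial_sum /= big_split.
Qed.

Lemma has_sumZ (k : K) u l : has_sum u l -> has_sum (fun x => k *: u x) (k *: l).
Proof.
move=> ul; rewrite /has_sum.
rewrite (_ : summability.partial_sum _ =
  (fun A => k *: summability.partial_sum u A)).
  exact: cvgZl_tmp.
by apply/funext => A; rewrite /summability.partial_sum /= scaler_sumr.
Qed.

End HasSum.

Section Dot.
Variables (R : realType) (S : choiceType).
Local Notation H := (ell2 R S).
Implicit Types (f g h : H).

Lemma partial_sum_fset (w : S -> R) (A : {fset S}) :
  summability.partial_sum (fun x => (w x)%:C : R[i]^o) A
    = (\sum_(x <- A) w x)%:C.
Proof.
rewrite big_seq_fsetE /= rmorph_sum //.
Qed.

(** With nonnegative terms the finite partial sums increase, so their net converges to their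
    supremum, which is what [\esum] denotes. *)
Lemma has_sum_ge0 (w : S -> R) (l : R) : (forall x, 0 <= w x) ->
  (\esum_(x in [set: S]) (w x)%:E = l%:E)%E ->
  has_sum (fun x => (w x)%:C : R[i]^o) l%:C.
Proof.
move=> w0 wl; apply/cvgrPdist_lt => e; case: e => e e' /=.
rewrite ltcE /= => /andP[/eqP-> e0].
have : ((l - e)%:E < \esum_(x in [set: S]) (w x)%:E)%E.
  by rewrite wl lte_fin ltrBlDr ltrDl.
move=> /ereal_sup_gt[_ [F [finF _] <-]].
rewrite fsbig_finite//= sumEFin lte_fin => lF.
exists (fset_set F) => // B /= FB.
rewrite partial_sum_fset -rmorphB normc_def /= expr0n addr0 sqrtr_sqr ltcR.
have FleB : \sum_(x <- fset_set F) w x <= \sum_(x <- B) w x.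
  rewrite (big_fsetID _ (mem (fset_set F)) B) /=.
  rewrite (_ : [fset x in B | x \in fset_set F]%fset = fset_set F).
    by rewrite lerDl sumr_ge0.
  by apply/fsetP => x; rewrite !inE /= andb_idl// => /(fsubsetP FB).
have Blel : \sum_(x <- B) w x <= l.
  rewrite -lee_fin -wl; apply: ereal_sup_ubound; exists [set` B] => //.
  by rewrite fsbig_finite//= set_fsetK sumEFin.
by rewrite ger0_norm; lra.
Qed.

Local Notation term f g := (fun x => f x * (g x)^* : R[i]^o).

Lemma mul_conjc (z : R[i]) : z * z^* = (Normc.normc z ^+ 2)%:C.
Proof.
case: z => a b; rewrite /= sqr_sqrtr ?addr_ge0 ?sqr_ge0//.
by apply/eqP; rewrite eq_complex /=; apply/andP; split; apply/eqP; ring.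
Qed.

Lemma sqr_ell2_norm f : `|f| ^+ 2 = (fine (sqnorm f))%:C.
Proof.
have f0 : (0 <= sqnorm f)%E.
  by apply: esum_ge0 => x _; rewrite lee_fin sqr_ge0.
by rewrite -rmorphXn /= sqr_sqrtr// fine_ge0.
Qed.

Lemma has_sum_norm f : has_sum (term f f) (`|f| ^+ 2).
Proof.
rewrite sqr_ell2_norm.
rewrite (_ : (fun x => _) = fun x => (Normc.normc (f x) ^+ 2)%:C : R[i]^o).
  apply: has_sum_ge0 => [x|]; first exact: sqr_ge0.
  by rewrite fineK// ge0_fin_numE; [case: f => f /= /asboolP|
    apply: esum_ge0 => x _; rewrite lee_fin sqr_ge0].
by apply/funext => x; rewrite mul_conjc.
Qed.

Arguments has_sum_norm : clear implicits.

Lemma has_sum_dot f g : has_sum (term f g) (dot f g).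
Proof.
suff [l fgl] : exists l, has_sum (term f g) l.
  by rewrite /dot (has_sum_eq fgl).
(* Polarization. Splitting into four positive series also avoids the
   completeness of R[i]. *)
pose r : R := 4^-1.
have h1 := has_sumZ (k := r%:C) (has_sum_norm (f + g)).
have h2 := has_sumZ (k := (- r)%:C) (has_sum_norm (f - g)).
have h3 := has_sumZ (k := 0 +i* r) (has_sum_norm (f + (0 +i* 1) *: g)).
have h4 := has_sumZ (k := 0 +i* (- r)) (has_sum_norm (f - (0 +i* 1) *: g)).
have := has_sumD (has_sumD h1 h2) (has_sumD h3 h4).
set l := (X in has_sum _ X); set w := (X in has_sum X _) => wl.
exists l; rewrite (_ : (fun x => _) = w)//; apply/funext => x.
pose sq (z : R[i]) := z * z^*.
have -> : w x =
    (r%:C * sq (f x + g x) + (- r)%:C * sq (f x - g x)) +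
    ((0 +i* r) * sq (f x + (0 +i* 1) * g x) +
     (0 +i* (- r)) * sq (f x - (0 +i* 1) * g x)) by [].
rewrite /sq; move: (f x) (g x) => [a b] [c d]; simpc.
by apply/eqP; rewrite eq_complex /= /r; apply/andP; split; apply/eqP; field.
Qed.

Arguments has_sum_dot : clear implicits.

Lemma dot_eq f g l : has_sum (term f g) l -> dot f g = l.
Proof. by move=> fgl; rewrite /dot (has_sum_eq fgl). Qed.

Lemma dot_eq0 f g : (forall x, f x = 0 \/ g x = 0) -> dot f g = 0.
Proof.
move=> fg0; apply: dot_eq.
rewrite (_ : (fun x => _) = fun=> 0).
  apply: cvg_near_cst; near=> A; rewrite /summability.partial_sum.
  by rewrite big1.
by apply/funext => x; have [->|->] := fg0 x; rewrite ?rmorph0 ?mul0r ?mulr0.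
Unshelve. all: by end_near. Qed.

Lemma dot_linear (k : R[i]) f g h : dot (k *: f + g) h = k * dot f h + dot g h.
Proof.
apply: dot_eq; rewrite (_ : (fun x => _) =
  (fun x => k *: (f x * (h x)^* : R[i]^o)) \+ term g h).
  exact: has_sumD (has_sumZ (has_sum_dot f h)) (has_sum_dot g h).
apply/funext => x; rewrite -[LHS]/((k * f x + g x) * (h x)^*).
by rewrite -[RHS]/(k * (f x * (h x)^*) + g x * (h x)^*) mulrDl mulrA.
Qed.

Lemma has_sumJ (u : S -> R[i]^o) (l : R[i]) :
  has_sum u l -> has_sum (fun x => (u x : R[i])^* : R[i]^o) (l^* : R[i]^o).
Proof.
have distJ (a b : R[i]) : `|a^* - b^*| = `|a - b|.
  by rewrite -rmorphB norm_conjC.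
move=> /cvgrPdist_lt ul; apply/cvgrPdist_lt => e /ul.
apply: filterS => A; rewrite -distJ; congr (is_true (`|_ - _| < _)).
exact: rmorph_sum.
Qed.

Lemma dotC f g : dot g f = (dot f g)^*.
Proof.
apply: dot_eq; rewrite (_ : term g f = fun x => (f x * (g x)^*)^*).
  exact: has_sumJ (has_sum_dot f g).
by apply/funext => x; rewrite rmorphM mulrC; congr (_ * _); exact: esym (conjCK _).
Qed.

Lemma dotDl f g h : dot (f + g) h = dot f h + dot g h.
Proof. by rewrite -{1}[f]scale1r dot_linear mul1r. Qed.

Lemma dotZl (k : R[i]) f h : dot (k *: f) h = k * dot f h.
Proof.
rewrite -[k *: f]addr0 dot_linear (_ : dot 0 h = 0) ?addr0//.
by apply: dot_eq0 => x; left.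
Qed.

Lemma dotDr f g h : dot h (f + g) = dot h f + dot h g.
Proof. by rewrite dotC dotDl rmorphD /= -!dotC. Qed.

Lemma dotZr (k : R[i]) f h : dot h (k *: f) = k^* * dot h f.
Proof. by rewrite dotC dotZl rmorphM /= -!dotC. Qed.

Lemma dotBl f g h : dot (f - g) h = dot f h - dot g h.
Proof. by rewrite -scaleN1r dotDl dotZl mulN1r. Qed.

Lemma dotBr f g h : dot h (f - g) = dot h f - dot h g.
Proof. by rewrite dotC dotBl rmorphB /= -!dotC. Qed.

Lemma dot_norm f : dot f f = `|f| ^+ 2.
Proof. exact/dot_eq/has_sum_norm. Qed.

Lemma dot_ext f g : (forall h, dot h f = dot h g) -> f = g.
Proof.
move=> fg; apply/eqP; rewrite -subr_eq0 -normr_eq0 -sqrf_eq0 -dot_norm.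
by rewrite dotBr fg subrr.
Qed.

Lemma dot_cauchy_schwarz f g : `|dot f g| <= `|f| * `|g|.
Proof.
have [->|g0] := eqVneq g 0.
  rewrite (_ : dot f 0 = 0) ?normr0 ?mulr0//.
  by apply: dot_eq0 => x; right.
(* Expanding |N f - c g|^2 >= 0 gives N (N |f|^2 - |c|^2) >= 0; the scaling by N avoids dividing by
   |g|^2. *)
pose N : R[i] := `|g| ^+ 2; pose c := dot f g.
have N0 : 0 < N by rewrite exprn_gt0// normr_gt0.
have NJ : N^* = N by rewrite /N sqr_ell2_norm; exact: conjc_real.
rewrite -(@ler_pXn2r _ 2)// ?nnegrE ?mulr_ge0// exprMn normCK -/N -/c.
rewrite -subr_ge0 -(pmulr_rge0 _ N0).
have := exprn_ge0 2 (normr_ge0 (N *: f - c *: g)).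
rewrite -(dot_norm (_ - _)) dotBl !dotBr !dotZl !dotZr (dotC f g) NJ.
rewrite !dot_norm -/N -/c => h; apply: (le_trans h).
by rewrite le_eqVlt; apply/orP; left; apply/eqP; ring.
Qed.

End Dot.

(** * Adjoints *)

Section ClosureNorm.
Variables (K : numFieldType) (V : normedModType K).
Implicit Types (E : set V) (a : V).

Lemma closure_normP E a :
  closure E a <-> forall e : K, 0 < e -> exists2 b, E b & `|a - b| < e.
Proof.
split=> [Ea e e0|Ea B /nbhs_ballP[e /= e0 eB]].
  have [b [Eb /=]] := Ea _ (nbhsx_ballx a _ e0).
  by rewrite -ball_normE; exists b.
have [b Eb abe] := Ea e e0.
by exists b; split=> //; apply: eB; rewrite -ball_normE.
Qed.

Lemma lipschitz_continuous (W : normedModType K) (T : V -> W) (M : K) :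
  0 <= M -> (forall a b, `|T a - T b| <= M * `|a - b|) -> continuous T.
Proof.
move=> M0 TM a; apply/cvgrPdist_lt => e e0.
(* M may be 0, so e is divided by M + 1; the same device recurs in later estimates. *)
have M1 : 0 < M + 1 by rewrite ltr_wpDl.
near=> b; apply: le_lt_trans (TM _ _) _.
apply: (@le_lt_trans _ _ ((M + 1) * `|a - b|)).
  by rewrite ler_wpM2r// lerDl.
rewrite mulrC -ltr_pdivlMr//; near: b.
by apply: cvgr_dist_lt => //; rewrite divr_gt0.
Unshelve. all: by end_near. Qed.

End ClosureNorm.

Lemma closure_continuous_sub (T U : topologicalType) (f : T -> U) (E : set T)
    (C : set U) : continuous f -> closed C -> (forall a, E a -> C (f a)) ->
  forall a, closure E a -> C (f a).
Proof.
by move=> /continuous_closedP fC /fC Cf EC a; rewrite closureE => /(_ _ (conj Cf EC)).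
Qed.

Section Adjoint.
Variables (R : realType) (S : choiceType).
Local Notation B := (bop (ell2 R S)).
Implicit Types (a b : B).

Lemma is_adjoint_sym a b : is_adjoint a b -> is_adjoint b a.
Proof. by move=> ab f g; rewrite dotC -ab -dotC. Qed.

Lemma adj_eq a b : is_adjoint a b -> adj a = b.
Proof.
move=> ab; rewrite /adj; case: xgetP => [c _ /= ac|/(_ b)/(_ ab)//].
by apply/val_inj/funext => g; apply: dot_ext => f; rewrite -ac ab.
Qed.

Lemma is_adjoint_linear (k : R[i]) a a' b b' :
  is_adjoint a a' -> is_adjoint b b' ->
  is_adjoint (k *: a + b) (k^* *: a' + b').
Proof.
move=> aa' bb' f g.
rewrite -[(k *: a + b) f]/(k *: a f + b f) dotDl dotZl aa' bb'.
rewrite -[(k^* *: a' + b') g]/(k^* *: a' g + b' g) dotDr dotZr.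
by congr (_ * _ + _); exact: esym (conjCK _).
Qed.

Lemma is_adjoint_mul a a' b b' :
  is_adjoint a a' -> is_adjoint b b' -> is_adjoint (a * b) (b' * a').
Proof. by move=> aa' bb' f g; rewrite -[(a * b) f]/(a (b f)) aa' bb'. Qed.

Lemma bop_normP a f : `|a f| <= `|a| * `|f|.
Proof. exact: ler_opnorm. Qed.

Lemma bop_norm_le a (M : R[i]) : 0 <= M ->
  (forall f, `|a f| <= M * `|f|) -> `|a| <= M.
Proof.
move=> M0 aM; have M1 : M = (Normc.normc M)%:C by rewrite -[LHS]ger0_norm.
rewrite M1 lecR; apply: opnorm_le => [|f]; first by rewrite -ler0c -M1.
by rewrite -M1.
Qed.

Lemma bop_norm_mul a b : `|a * b| <= `|a| * `|b|.
Proof.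
apply: bop_norm_le => [|f]; first by rewrite mulr_ge0.
rewrite -[(a * b) f]/(a (b f)); apply: le_trans (bop_normP _ _) _.
by rewrite -mulrA ler_wpM2l// bop_normP.
Qed.

(** |b g|^2 = <a (b g), g> <= |a| |b g| |g|, and |b g| cancels. This bound lets adjoints pass to
    norm limits. *)
Lemma norm_is_adjoint_le a b : is_adjoint a b -> `|b| <= `|a|.
Proof.
move=> ab; apply: bop_norm_le => // g.
have [->|bg0] := eqVneq (b g) 0; first by rewrite normr0 mulr_ge0.
have bg_gt0 : 0 < `|b g| by rewrite normr_gt0.
rewrite -(ler_pM2l bg_gt0) -expr2 -dot_norm -ab.
have dot_ge0 : 0 <= dot (a (b g)) g by rewrite ab dot_norm exprn_ge0.
rewrite -(ger0_norm dot_ge0); apply: le_trans (dot_cauchy_schwarz _ _) _.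
by rewrite mulrA ler_wpM2r// mulrC bop_normP.
Qed.

(* An operator without adjoint has [adj a = 0], so that the existence of adjoints
   of arbitrary bounded operators is not needed here. *)
Lemma closure_cstar_subalgebra (E : set B) :
  E 0 -> (forall (k : R[i]) a b, E a -> E b -> E (k *: a + b)) ->
  (forall a b, E a -> E b -> E (a * b)) ->
  (forall a, E a -> exists2 b, E b & is_adjoint a b) ->
  cstar_subalgebra (closure E).
Proof.
have clE := @closed_closure _ E.
move=> E0 EL EM EJ; split.
- exact: closed_closure.
- exact: subset_closure.
- move=> k a b Ea Eb.
  have addE c : continuous (fun a => k *: a + c : B).
    apply: (@lipschitz_continuous _ _ _ _ `|k|) => // u v.
    by rewrite opprD addrACA subrr addr0 -scalerBr normrZ.
  have addE' c : continuous (fun b => c + b : B).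
    apply: (@lipschitz_continuous _ _ _ _ 1) => // u v.
    by rewrite mul1r opprD addrACA subrr add0r.
  apply: (closure_continuous_sub (addE' (k *: a)) clE _ Eb) => {Eb}{}b Eb.
  apply: (closure_continuous_sub (addE b) clE _ Ea) => {Ea}{}a Ea.
  exact/subset_closure/EL.
- move=> a b Ea Eb.
  have mulE c : continuous (fun b => c * b : B).
    apply: (@lipschitz_continuous _ _ _ _ `|c|) => // u v.
    by rewrite -mulrBr bop_norm_mul.
  have mulE' c : continuous (fun b => b * c : B).
    apply: (@lipschitz_continuous _ _ _ _ `|c|) => // u v.
    by rewrite -mulrBl mulrC bop_norm_mul.
  apply: (closure_continuous_sub (mulE a) clE _ Eb) => {Eb}{}b Eb.
  apply: (closure_continuous_sub (mulE' b) clE _ Ea) => {Ea}{}a Ea.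
  exact/subset_closure/EM.
- move=> a Ea.
  have [[a' aa']|na] := pselect (exists a', is_adjoint a a'); last first.
    rewrite /adj xgetPN; first exact: subset_closure.
    by move=> b ab; apply: na; exists b.
  rewrite (adj_eq aa'); apply/closure_normP => e e0.
  have [b Eb abe] := (closure_normP _ _).1 Ea e e0.
  have [b' Eb' bb'] := EJ _ Eb.
  exists b'; first exact: Eb'.
  (* By linearity a' - b' is the adjoint of a - b, so approximating a by b approximates a' by b'
     equally well. *)
  apply: le_lt_trans abe; apply: norm_is_adjoint_le.
  have := is_adjoint_linear (-1) bb' aa'.
  by rewrite rmorphN1 !scaleN1r ![- _ + _]addrC.
Qed.
End Adjoint.

(** * The complex exponential *)

(** A remainder of order |h|^2 is o(h). In this form, complex differentiability of the exponential
    reduces to real inequalities for [expR], [cos] and [sin]. *)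
Lemma derivable_of_quadratic (K : numFieldType) (W : normedModType K)
    (f : K^o -> W) (z : K^o) (d : W) (C r : K) : 0 < r -> 0 <= C ->
  (forall h : K, `|h| < r -> `|f (h + z) - f z - h *: d| <= C * `|h| ^+ 2) ->
  derivable f z 1.
Proof.
move=> r0 C0 fC; apply/cvg_ex; exists d; apply/cvgrPdist_lt => e e0.
have C1 : 0 < C + 1 by rewrite ltr_wpDl.
near=> h.
have h0 : h != 0 by near: h; exact: nbhs_dnbhs_neq.
have hr : `|h| < r by near: h; apply: dnbhs0_lt.
have he : `|h| < e / (C + 1) by near: h; apply: dnbhs0_lt; rewrite divr_gt0.
have hp : 0 < `|h| by rewrite normr_gt0.
rewrite /= [h *: 1]mulr1 distrC.
rewrite -[d in X in X < _](scalerK h0) -scalerBr normrZ normfV.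
rewrite ltr_pdivrMl//; apply: le_lt_trans (fC h hr) _.
rewrite expr2 mulrCA ltr_pM2l//.
apply: (@le_lt_trans _ _ ((C + 1) * `|h|)); first by rewrite ler_wpM2r// lerDl.
by rewrite mulrC -ltr_pdivlMr.
Unshelve. all: by end_near. Qed.

Section ComplexExponential.
Variable R : realType.
Implicit Types (x y : R) (z h : R[i]).

(** Mean value theorem on [0, x], after a reduction to x >= 0 by parity. This bound gives the next
    one, for [cos], which in turn gives the second-order bound for [sin]. *)
Lemma norm_sin_le x : `|sin x| <= `|x|.
Proof.
wlog x0 : x / 0 <= x => [hw|].
  have [/hw//|/ltW x0] := leP 0 x.
  by have := hw (- x); rewrite sinN !normrN oppr_ge0; exact.
have [c _] := MVT_segment (f := sin) x0 (fun u _ => is_derive_sin u)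
  (continuous_subspaceT (@continuous_sin R)).
rewrite sin0 !subr0 => ->.
by rewrite normrM ler_piMl// cos_max.
Qed.

Lemma norm_cosB1_le x : `|cos x - 1| <= x ^+ 2.
Proof.
wlog x0 : x / 0 <= x => [hw|].
  have [/hw//|/ltW x0] := leP 0 x.
  by have := hw (- x); rewrite cosN sqrrN oppr_ge0; exact.
have [c cx] := MVT_segment (f := cos) x0 (fun u _ => is_derive_cos u)
  (continuous_subspaceT (@continuous_cos R)).
move: cx; rewrite in_itv /= => /andP[c0 cx].
rewrite cos0 !subr0 => ->; rewrite normrM normrN expr2 (ger0_norm x0).
by rewrite ler_wpM2r// (le_trans (norm_sin_le _))// ger0_norm.
Qed.

Lemma norm_sinBid_le x : `|x| <= 1 -> `|sin x - x| <= x ^+ 2.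
Proof.
wlog x0 : x / 0 <= x => [hw|].
  have [/hw//|/ltW x0] := leP 0 x.
  by have := hw (- x); rewrite sinN -opprD sqrrN !normrN oppr_ge0; exact.
rewrite ger0_norm// => x1.
have [c cx] := MVT_segment (f := sin) x0 (fun u _ => is_derive_sin u)
  (continuous_subspaceT (@continuous_sin R)).
move: cx; rewrite in_itv /= => /andP[c0 cx].
rewrite sin0 !subr0 => ->.
rewrite -[X in _ - X]mul1r -mulrBl normrM (ger0_norm x0) expr2 ler_wpM2r//.
apply: le_trans (norm_cosB1_le _) _.
by rewrite expr2 (le_trans (ler_wpM2l c0 cx))// ler_piMl// (le_trans cx).
Qed.

Lemma expRB1Bid_le x : `|x| <= 2^-1 -> 0 <= expR x - 1 - x <= 2 * x ^+ 2.
Proof.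
move=> x2; have /ler_normlP[x2l x2r] := x2.
have := expR_ge1Dx x; have := expR_ge1Dx (- x); rewrite expRN => h1 h2.
apply/andP; split; first by lra.
have e0 := expR_gt0 x.
(* From 1 - x <= exp(-x): exp x <= 1/(1 - x) = 1 + x + x^2/(1 - x), where 1 - x >= 1/2. *)
have h3 : (1 - x) * expR x <= 1.
  by rewrite -ler_pdivlMr// mul1r.
nra.
Qed.

Definition cexp z : R[i] := let: x +i* y := z in
  (expR x * cos y) +i* (expR x * sin y).

Lemma cexpD z h : cexp (z + h) = cexp z * cexp h.
Proof.
case: z h => a b [c d]; rewrite /cexp /=; simpc.
rewrite expRD sinD cosD; apply/eqP; rewrite eq_complex /=.
by apply/andP; split; apply/eqP; ring.
Qed.

Lemma normc_le_ReIm (a b : R) : Normc.normc (a +i* b) <= `|a| + `|b|.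
Proof.
rewrite /= -[leRHS]ger0_norm ?addr_ge0// -sqrtr_sqr ler_sqrt ?sqr_ge0//.
rewrite sqrrD !real_normK ?num_real// lerD2r lerDl.
by rewrite mulrn_wge0// mulr_ge0.
Qed.

Lemma cexp_quadratic h : Normc.normc h <= 2^-1 ->
  Normc.normc (cexp h - 1 - h) <= 4 * Normc.normc h ^+ 2.
Proof.
case: h => a b; set r := Normc.normc _ => r2.
have rE : r ^+ 2 = a ^+ 2 + b ^+ 2 by rewrite sqr_sqrtr// addr_ge0// sqr_ge0.
have r0 : 0 <= r by rewrite sqrtr_ge0.
have ar : `|a| <= r.
  by rewrite -(@ler_pXn2r _ 2)// ?nnegrE// rE real_normK ?num_real// lerDl sqr_ge0.
have br : `|b| <= r.
  by rewrite -(@ler_pXn2r _ 2)// ?nnegrE// rE real_normK ?num_real// lerDr sqr_ge0.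
have /andP[ea0 ea] := expRB1Bid_le (le_trans ar r2).
have cb := norm_cosB1_le b.
have sb : `|sin b - b| <= b ^+ 2.
  by apply: norm_sinBid_le; rewrite (le_trans br)// (le_trans r2)// invf_le1// ler1n.
(* This grouping makes every summand quadratic in (a, b). The bounds below add up to (7/2) a^2 + 3
   b^2, whence the constant 4. *)
have -> : cexp (a +i* b) - 1 - (a +i* b) =
  ((expR a - 1 - a) * cos b + (1 + a) * (cos b - 1)) +i*
  ((expR a - 1 - a) * sin b + (a * sin b + (sin b - b))).
  rewrite /cexp; simpc.
  by apply/eqP; rewrite eq_complex /=; apply/andP; split; apply/eqP; ring.
apply: le_trans (normc_le_ReIm _ _) _.
have h1 : `|(expR a - 1 - a) * cos b| <= 2 * a ^+ 2.
  by rewrite normrM ger0_norm// (le_trans _ ea)// ler_piMr// cos_max.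
have h2 : `|(1 + a) * (cos b - 1)| <= 3 / 2 * b ^+ 2.
  rewrite normrM ler_pM//; apply: le_trans (ler_normD _ _) _.
  by rewrite normr1; lra.
have h3 : `|(expR a - 1 - a) * sin b| <= a ^+ 2.
  rewrite normrM ger0_norm//.
  have s2 : `|sin b| <= 2^-1 by rewrite (le_trans (norm_sin_le _))// (le_trans br).
  apply: (@le_trans _ _ (2 * a ^+ 2 * 2^-1)); first by rewrite ler_pM.
  by rewrite mulrAC divff ?mul1r.
have h4 : `|a * sin b| <= 2^-1 * (a ^+ 2 + b ^+ 2).
  rewrite normrM (le_trans (ler_wpM2l _ (norm_sin_le b)))//.
  rewrite -(real_normK (num_real a)) -(real_normK (num_real b)).
  have := sqr_ge0 (`|a| - `|b|); rewrite sqrrB; lra.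
have a2 := sqr_ge0 a; have b2 := sqr_ge0 b.
rewrite rE; apply: le_trans (lerD (ler_normD _ _) (ler_normD _ _)) _.
have := ler_normD (a * sin b) (sin b - b); lra.
Qed.

Lemma derivable_cexp (V : normedModType R[i]) (k : R[i]) (a : V) (z : R[i]^o) :
  derivable (fun w : R[i]^o => cexp (k * w) *: a) z 1.
Proof.
have normE (w : R[i]) : `|w| = (Normc.normc w)%:C by [].
(* The quadratic estimate will be used on the disc of radius 1/(2|k|), which requires k != 0. *)
have [->|k0] := eqVneq k 0.
  by under eq_fun do rewrite mul0r; exact: derivable_cst.
have nk : 0 < Normc.normc k.
  by rewrite -ltcR -normE normr_gt0.
apply: (@derivable_of_quadratic _ _ _ _ ((k * cexp (k * z)) *: a)
  (4 * `|k| ^+ 2 * (`|cexp (k * z)| * `|a|)) ((2 * Normc.normc k)^-1)%:C).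
- by rewrite ltcR invr_gt0 mulr_gt0.
- by rewrite !mulr_ge0.
move=> h; rewrite (normE h) ltcR => hr.
have kh : Normc.normc (k * h) <= 2^-1.
  by rewrite Normc.normcM mulrC -ler_pdivlMr// -invfM; exact: ltW.
have key : `|cexp (k * h) - 1 - k * h| <= 4 * `|k| ^+ 2 * `|h| ^+ 2.
  rewrite (normE (_ - _)) (normE k) (normE h) -mulrA -exprMn -rmorphM.
  rewrite -rmorphXn -Normc.normcM -(rmorph_nat (real_complex R) 4).
  by rewrite -(rmorphM (real_complex R)) lecR cexp_quadratic.
rewrite mulrDr cexpD scalerA -scalerBl -scalerBl.
have -> : cexp (k * h) * cexp (k * z) - cexp (k * z) - h * (k * cexp (k * z)) =
  (cexp (k * h) - 1 - k * h) * cexp (k * z) by ring.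
rewrite normrZ normrM -[leLHS]mulrA -(normE h) [leRHS]mulrAC.
by apply: ler_wpM2r key; rewrite mulr_ge0.
Qed.

End ComplexExponential.

(** * The Toeplitz algebra *)

Section TranslationAdjoint.
Variable R : realType.
Local Notation H := (ell2 R affsg).
Implicit Types (x y : affsg) (f g : H).

Lemma affmulA : associative affmul.
Proof.
move=> [m a] [n b] [p c]; rewrite /affmul /=; congr (_, _).
  by rewrite mulnDr addnA mulnA.
by apply: val_inj; rewrite /= mulnA.
Qed.

Lemma translate_off y (u : affsg -> R[i]) z :
  ~ range (affmul y) z -> translate y u z = 0.
Proof. by move=> yz; rewrite /translate ifN// notin_setE. Qed.

Lemma translate_on y (u : affsg -> R[i]) z : translate y u (affmul y z) = u z.
Proof. exact: Defs.translateE. Qed.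

Lemma isoT_mul x y : isoT R x * isoT R y = isoT R (affmul x y).
Proof.
apply/val_inj/funext => f; apply/val_inj/funext => z.
rewrite -[LHS]/(translate x (translate y f) z).
rewrite -[RHS]/(translate (affmul x y) f z).
have [[u _ <-]|xz] := pselect (range (affmul x) z); last first.
  rewrite !translate_off// => -[u _ uz].
  by apply: xz; exists (affmul y u) => //; rewrite affmulA.
rewrite translate_on; have [[w _ <-]|yu] := pselect (range (affmul y) u).
  by rewrite translate_on affmulA translate_on.
rewrite !translate_off// => -[w _]; rewrite -affmulA => /affmul_inj wu.
by apply: yu; exists w.
Qed.

Lemma sqnorm_cotranslate y (u : affsg -> R[i]) :
  (sqnorm (fun x => u (affmul y x)) <= sqnorm u)%E.
Proof.
rewrite /sqnorm -(esum_image _ _ (fun z => (Normc.normc (u z) ^+ 2)%:E)).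
  rewrite esum_mkcond; apply: le_esum => z _.
  by case: ifP => // _; rewrite lee_fin sqr_ge0.
by move=> ? ? _ _; exact: affmul_inj.
Qed.

Fact square_summable_cotranslate y f : square_summable (fun x => f (affmul y x)).
Proof.
apply/asboolP; apply: le_lt_trans (sqnorm_cotranslate y f) _.
by case: f => f /= /asboolP.
Qed.

(** Pulling back along x -> yx is the adjoint of [translation y]. *)
Definition cotranslation y f : H := Ell2 (square_summable_cotranslate y f).

Lemma translationK y : cancel (translation y) (cotranslation y : H -> H).
Proof. by move=> f; apply/val_inj/funext => z; exact: translate_on. Qed.

Lemma norm_translation y f : `|translation y f| = `|f|.
Proof. by rewrite /Num.norm /= /ell2_norm Defs.sqnorm_translate. Qed.

(** Polarization: since T_y preserves norms, it preserves k^* <f, g> + k <g, f> for every k. Taking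
    k = 1 gives the sum of the two products, k = i their difference. *)
Lemma dot_translation y f g : dot (translation y f) (translation y g) = dot f g.
Proof.
have linT : linear (@translation R y).
  by have /asboolP[? _] := bounded_linear_translation R y.
have TD (k : R[i]) : k^* * dot (translation y f) (translation y g) +
    k * dot (translation y g) (translation y f) = k^* * dot f g + k * dot g f.
  have expand (u v : H) : `|k *: v + u| ^+ 2 =
      `|k *: v| ^+ 2 + `|u| ^+ 2 + (k^* * dot u v + k * dot v u).
    by rewrite -!dot_norm dotDl !dotDr !dotZl !dotZr; ring.
  have := expand (translation y f) (translation y g).
  by rewrite -linT !normrZ !norm_translation expand normrZ => /addrI.
pose j : R[i] := 0 +i* 1.
have jj : j * j = -1 by rewrite /j; simpc.
have jJ : j^* = - j.
  by apply/eqP; rewrite eq_complex /= !oppr0 !eqxx.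
have := TD 1; have := congr1 ( *%R j) (TD j).
rewrite jJ rmorph1 !mul1r !mulrDr !mulNr !mulrN !mulrA jj !mulN1r !opprK.
set p := dot _ _; set q := dot _ _; set p' := dot _ _; set q' := dot _ _.
move=> e1 e2; apply: (@mulfI _ 2); first by rewrite pnatr_eq0.
have -> : 2 * p = (p - q) + (p + q) by ring.
by rewrite e1 e2; ring.
Qed.

Fact bounded_linear_cotranslation y : bounded_linear (cotranslation y).
Proof.
apply/asboolP; split=> [k f g|]; first exact/val_inj.
exists 1 => f; rewrite mul1r lecR ler_sqrt; last first.
  by apply/fine_ge0/esum_ge0 => x _; rewrite lee_fin sqr_ge0.
have fin (g : H) : sqnorm g \is a fin_num.
  rewrite ge0_fin_numE; first by case: g => g /= /asboolP.
  by apply/esum_ge0 => x _; rewrite lee_fin sqr_ge0.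
by apply: fine_le; rewrite ?fin//; exact: sqnorm_cotranslate.
Qed.

Definition coisoT y : bop H := Bop (bounded_linear_cotranslation y).

(** T_y f is supported on the range of x -> yx, where g and T_y T_y^* g agree. So <T_y f, g> = <T_y
    f, T_y T_y^* g> = <f, T_y^* g>. *)
Lemma isoT_adjoint y : is_adjoint (isoT R y) (coisoT y).
Proof.
move=> f g; rewrite -[isoT R y f]/(translation y f).
rewrite -[coisoT y g]/(cotranslation y g).
rewrite -(dot_translation y f (cotranslation y g)).
apply/eqP; rewrite -subr_eq0 -dotBr; apply/eqP/dot_eq0 => z.
have [[u _ <-]|yz] := pselect (range (affmul y) z); last first.
  by left; exact: translate_off.
right; rewrite -[LHS]/(g (affmul y u) -
  translate y (fun x => g (affmul y x)) (affmul y u)).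
by rewrite translate_on subrr.
Qed.

Lemma coisoT_isoT y : coisoT y * isoT R y = 1.
Proof. by apply/val_inj/funext => f; exact: translationK. Qed.

Lemma coisoT_isoT0 x y :
  (forall u v, affmul x u <> affmul y v) -> coisoT x * isoT R y = 0.
Proof.
move=> xy; apply/val_inj/funext => f; apply/val_inj/funext => u.
rewrite -[LHS]/(translate y f (affmul x u)) translate_off// => -[v _].
by move/esym/xy.
Qed.

End TranslationAdjoint.

(** * The star operation and the relations between the generators *)

Section ToeplitzStar.
Variable R : realType.
Local Notation T := (toeplitz R).
Implicit Types (a b c : T) (k : R[i]).

Lemma toeplitz_scalerAl k a b : (k *: a) * b = k *: (a * b).
Proof. exact/val_inj/val_inj. Qed.

Lemma toeplitz_scalerAr k a b : a * (k *: b) = k *: (a * b).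
Proof.
apply/val_inj/val_inj/funext => f.
rewrite -[LHS]/(val a (k *: val b f)) -[RHS]/(k *: val a (val b f)).
have /asboolP[la _] : bounded_linear (val a) by case: (val a).
have a0 : val a 0 = 0 by rewrite -[0 in LHS](subrr 0) -scaleN1r addrC la scaleN1r addNr.
by rewrite -[k *: _]addr0 la a0 addr0.
Qed.

Lemma toeplitz_norm_mul a b : `|a * b| <= `|a| * `|b|.
Proof. exact: bop_norm_mul. Qed.

(** Certifies that [star a] is a true adjoint and not the default value of [adj]; the algebraic
    rules for [star] are derived under this predicate. *)
Definition adjointable a : Prop := is_adjoint (val a) (val (star a)).

Lemma adjointable_of a b : is_adjoint (val a) (val b) ->
  adjointable a /\ star a = b.
Proof.
move=> ab; have sa : star a = b by apply/val_inj/adj_eq.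
by rewrite /adjointable sa.
Qed.

Lemma adjointable_star a : adjointable a -> adjointable (star a) /\ star (star a) = a.
Proof. by move=> aa; apply/adjointable_of/is_adjoint_sym. Qed.

Lemma adjointable1 : adjointable 1 /\ star 1 = 1 :> T.
Proof. exact: adjointable_of. Qed.

Lemma adjointable0 : adjointable 0 /\ star 0 = 0 :> T.
Proof.
by apply: adjointable_of => f g; rewrite !dot_eq0// => x; [right|left].
Qed.

Lemma adjointable_linear k a b : adjointable a -> adjointable b ->
  adjointable (k *: a + b) /\ star (k *: a + b) = k^* *: star a + star b.
Proof. by move=> aa bb; apply: adjointable_of; exact: (is_adjoint_linear k aa bb). Qed.

Lemma adjointable_mul a b : adjointable a -> adjointable b ->
  adjointable (a * b) /\ star (a * b) = star b * star a.
Proof. by move=> aa bb; apply: adjointable_of; exact: (is_adjoint_mul aa bb). Qed.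

Lemma Tgen_star y : adjointable (Tgen R y) /\ val (star (Tgen R y)) = coisoT R y.
Proof.
have sT : val (star (Tgen R y)) = coisoT R y by apply/adj_eq/isoT_adjoint.
by split=> //; rewrite /adjointable sT; exact: isoT_adjoint.
Qed.

Lemma Tgen_mul x y : Tgen R x * Tgen R y = Tgen R (affmul x y).
Proof. exact/val_inj/isoT_mul. Qed.

Lemma Tgen1 : Tgen R affone = 1.
Proof. exact/val_inj/isoT1. Qed.

Lemma star_Tgen_mul y : star (Tgen R y) * Tgen R y = 1.
Proof.
apply/val_inj; rewrite -[LHS]/(val (star (Tgen R y)) * isoT R y).
by rewrite (Tgen_star y).2 coisoT_isoT.
Qed.

Lemma star_Tgen_mul0 x y : (forall u v, affmul x u <> affmul y v) ->
  star (Tgen R x) * Tgen R y = 0.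
Proof.
move=> xy; apply/val_inj; rewrite -[LHS]/(val (star (Tgen R x)) * isoT R y).
by rewrite (Tgen_star x).2 coisoT_isoT0.
Qed.

End ToeplitzStar.

(** * Eigenvectors of the dynamics *)

Section Homogeneous.
Variables (R : realType) (sigma : R -> toeplitz R -> toeplitz R).
Hypothesis dyn : is_dynamics sigma.
Local Notation T := (toeplitz R).
Implicit Types (a b c : T) (k : R[i]) (l m t : R).

(** The character exp(i l t), written through [cexp] so that it is literally the restriction to real
    t of the entire function in [homogeneous_extension]. *)
Definition phase l t : R[i] := cexp ((0 +i* l) * t%:C).

Lemma phaseE l t : phase l t = cos (t * l) +i* sin (t * l).
Proof. by rewrite /phase /cexp; simpc; rewrite expR0 !mul1r mulrC. Qed.

Lemma phaseD l m t : phase l t * phase m t = phase (l + m) t.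
Proof.
rewrite /phase -cexpD -mulrDl; congr (cexp (_ * _)).
by apply/eqP; rewrite eq_complex /= addr0 !eqxx.
Qed.

Lemma phase0 t : phase 0 t = 1.
Proof. by rewrite phaseE mulr0 cos0 sin0. Qed.

Lemma phaseJ l t : (phase l t)^* = phase (- l) t.
Proof. by rewrite !phaseE mulrN cosN sinN. Qed.

(** Eigenvectors of frequency l, closed under products and stars up to a change of l. Adjointability
    is bundled in because [star] must behave on them. *)
Definition homogeneous l a : Prop :=
  adjointable a /\ forall t, sigma t a = phase l t *: a.

Lemma homogeneous_mul l m a b :
  homogeneous l a -> homogeneous m b -> homogeneous (l + m) (a * b).
Proof.
move=> [aa la] [bb mb]; split; first exact: (adjointable_mul aa bb).1.
move=> t; have [/(_ t)[_ sM _ _] _ _ _ _] := dyn.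
by rewrite sM la mb toeplitz_scalerAl toeplitz_scalerAr scalerA phaseD.
Qed.

Lemma homogeneous_star l a : homogeneous l a -> homogeneous (- l) (star a).
Proof.
move=> [aa la]; split; first exact: (adjointable_star aa).1.
move=> t; have [/(_ t)[_ _ sS _] _ _ _ _] := dyn.
have [a0 s0] := adjointable0 R.
rewrite sS la -[_ *: a]addr0 (adjointable_linear _ aa a0).2 s0 addr0.
by congr (_ *: _); exact: phaseJ.
Qed.

Lemma homogeneous_linear k l a b :
  homogeneous l a -> homogeneous l b -> homogeneous l (k *: a + b).
Proof.
move=> [aa la] [bb lb]; split; first exact: (adjointable_linear k aa bb).1.
move=> t; have [/(_ t)[sL _ _ _] _ _ _ _] := dyn.
by rewrite sL la lb scalerDr !scalerA mulrC.
Qed.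

(** [star_automorphism] has no clause for the unit, but 1 = s^* s and sigma fixes s. *)
Lemma homogeneous1 : homogeneous 0 1.
Proof.
split; first exact: (adjointable1 R).1.
move=> t; have [/(_ t)[_ sM sS _] _ _ sG _] := dyn.
rewrite phase0 scale1r -(star_Tgen_mul _ (1%N, posnat_one)) sM sS.
by rewrite -/(gen_s R) sG.
Qed.

Lemma homogeneous0 l : homogeneous l 0.
Proof.
split; first exact: (adjointable0 R).1.
move=> t; have [/(_ t)[sL _ _ _] _ _ _ _] := dyn.
by rewrite scaler0 -[0 in LHS](subrr 0) -scaleN1r addrC sL scaleN1r addNr.
Qed.

Lemma homogeneous_gen_s : homogeneous 0 (gen_s R).
Proof.
split; first exact: (Tgen_star _ _).1.
by move=> t; have [_ _ _ -> _] := dyn; rewrite phase0 scale1r.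
Qed.

Lemma gen_v_mul (p q : posnat) : gen_v R p * gen_v R q = gen_v R (posnat_mul p q).
Proof. by rewrite Tgen_mul /affmul /= muln0. Qed.

(** The dynamics is prescribed at primes only: strong induction splits off the least prime factor,
    and multiplicativity of v turns the product into a sum of logarithms. *)
Lemma homogeneous_gen_v (p : posnat) : homogeneous (ln (val p)%:R) (gen_v R p).
Proof.
have [n] := ubnP (val p); elim: n p => // n IH p pn.
have [p1|p1] := leqP (val p) 1.
  have pE : p = posnat_one.
    by apply: val_inj; apply/eqP; rewrite eqn_leq p1 (valP p).
  rewrite pE ln1 -[gen_v R _]/(Tgen R affone) Tgen1; exact: homogeneous1.
have pd0 := pdiv_gt0 (val p).
have d0 : (0 < val p %/ pdiv (val p))%N.
  by rewrite divn_gt0// dvdn_leq// ?pdiv_dvd// (valP p).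
pose q : posnat := Sub (pdiv (val p)) pd0.
pose d : posnat := Sub (val p %/ pdiv (val p))%N d0.
have pE : p = posnat_mul q d.
  by apply: val_inj; rewrite /= mulnC divnK// pdiv_dvd.
have -> : ln (val p)%:R = ln (val q)%:R + ln (val d)%:R :> R.
  by rewrite -lnM ?posrE ?ltr0n// -natrM pE.
rewrite pE -gen_v_mul; apply: homogeneous_mul; last first.
  apply: IH; rewrite /= -ltnS (leq_trans _ pn)// ltnS.
  by rewrite ltn_Pdiv ?(valP p)// prime_gt1// pdiv_prime.
split; first exact: (Tgen_star _ _).1.
move=> t; have [_ _ _ _ ->] := dyn; last exact: pdiv_prime.
by rewrite phaseE.
Qed.

Lemma Tgen_split (y : affsg) : Tgen R y = gen_s R ^+ y.1 * gen_v R y.2.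
Proof.
case: y => m a /=; elim: m => [|m IH]; first by rewrite expr0 mul1r.
rewrite exprS -mulrA -IH Tgen_mul; congr Tgen; rewrite /affmul /= mul1n add1n.
by congr (_, _); apply: val_inj; rewrite /= mul1n.
Qed.

Lemma homogeneous_Tgen (y : affsg) : homogeneous (ln (val y.2)%:R) (Tgen R y).
Proof.
rewrite Tgen_split -[ln _]add0r; apply: homogeneous_mul; last exact: homogeneous_gen_v.
elim: y.1 => [|n IH]; first by rewrite expr0; exact: homogeneous1.
by rewrite exprS -[0]addr0; apply: homogeneous_mul IH; exact: homogeneous_gen_s.
Qed.

(** The frequency may change from term to term. Building the sum one eigenvector at a time makes
    each induction meet a single homogeneous head. *)
Inductive homogeneous_span : T -> Prop :=
| homogeneous_span0 : homogeneous_span 0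
| homogeneous_spanD k l a b : homogeneous l a -> homogeneous_span b ->
    homogeneous_span (k *: a + b).

Lemma homogeneous_span_linear k a b :
  homogeneous_span a -> homogeneous_span b -> homogeneous_span (k *: a + b).
Proof.
move=> sa sb; elim: sa => [|k' l c d hc _ IH]; first by rewrite scaler0 add0r.
by rewrite scalerDr scalerA -addrA; apply: homogeneous_spanD hc IH.
Qed.

Lemma homogeneous_span_mul a b :
  homogeneous_span a -> homogeneous_span b -> homogeneous_span (a * b).
Proof.
move=> sa sb; elim: sa => [|k l c d hc _ IH].
  by rewrite mul0r; exact: homogeneous_span0.
rewrite mulrDl toeplitz_scalerAl; apply: homogeneous_span_linear IH.
elim: sb => [|k' l' c' d' hc' _ IH'].
  by rewrite mulr0; exact: homogeneous_span0.
rewrite mulrDr toeplitz_scalerAr; apply: homogeneous_spanD IH'.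
exact: homogeneous_mul hc hc'.
Qed.

Lemma homogeneous_span_star a : homogeneous_span a ->
  adjointable a /\ homogeneous_span (star a).
Proof.
elim=> [|k l c d hc _ [dd sd]].
  split; first exact: (homogeneous0 0).1.
  rewrite (adjointable0 R).2; exact: homogeneous_span0.
have [h1 ->] := adjointable_linear k hc.1 dd; split=> //.
by apply: homogeneous_spanD sd; exact: homogeneous_star hc.
Qed.

(** An element of the Toeplitz algebra lies in every C*-subalgebra of operators containing all T_y,
    and the closure of the span is one. *)
Lemma homogeneous_span_dense a (e : R[i]) : 0 < e ->
  exists2 b, homogeneous_span b & `|a - b| < e.
Proof.
move=> e0.
have cstar : cstar_subalgebra (closure (val @` homogeneous_span : set (bop _))).
  apply: closure_cstar_subalgebra.
  - by exists 0 => //; exact: homogeneous_span0.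
  - move=> k _ _ [u su <-] [v sv <-]; exists (k *: u + v) => //.
    exact: homogeneous_span_linear.
  - move=> _ _ [u su <-] [v sv <-]; exists (u * v) => //.
    exact: homogeneous_span_mul.
  - move=> _ [u su <-]; have [uu ss] := homogeneous_span_star su.
    by exists (val (star u)) => //; exists (star u).
have : closure (val @` homogeneous_span) (val a).
  have /asboolP aT := valP a; apply: (aT _) => //; split => // _ [y _ <-].
  apply: subset_closure; exists (Tgen R y) => //.
  rewrite -[Tgen R y]scale1r -[_ *: _]addr0.
  by apply: homogeneous_spanD (homogeneous_Tgen y) homogeneous_span0.
move=> /closure_normP/(_ _ e0)[_ [b sb <-] abe]; exists b => //.
Qed.

Lemma homogeneous_extension l a : homogeneous l a ->
  entire_extension sigma a (fun z => cexp ((0 +i* l) * z) *: a).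
Proof.
by move=> [_ la]; split=> [z|t]; [exact: derivable_cexp|rewrite la].
Qed.

End Homogeneous.

(** * KMS states *)

Lemma quadratic_ge0_eq0 (R : realFieldType) (a b : R) :
  (forall x, 0 <= x ^+ 2 * a + x * b) -> b = 0.
Proof.
move=> h; have n0 : 0 < `|a| + 1 by rewrite ltr_wpDl.
(* Multiplied by (|a| + 1)^2, the hypothesis at this point reads b^2 (a - |a| - 1) >= 0, whose
   second factor is at most -1. *)
have := h (- (b / (`|a| + 1))); rewrite sqrrN exprMn mulNr => h1.
have an : a <= `|a| by exact: ler_norm.
apply/eqP; rewrite -sqrf_eq0 eq_le sqr_ge0 andbT.
have : 0 <= b ^+ 2 * (a - (`|a| + 1)).
  have -> : b ^+ 2 * (a - (`|a| + 1)) =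
    (b ^+ 2 * (`|a| + 1)^-1 ^+ 2 * a - b / (`|a| + 1) * b) * (`|a| + 1) ^+ 2.
    by field; rewrite gt_eqF.
  by rewrite mulr_ge0// sqr_ge0.
have := sqr_ge0 b; nra.
Qed.

(** Nonnegative elements of [R[i]] are real, so each k yields an equation and an inequality. Real k
    gives b2 + c2 = 0 and b1 + c1 = 0; imaginary k gives c1 - b1 = 0 and b2 - c2 = 0. *)
Lemma hermitian_ge0_eq0 (R : rcfType) (A B C : R[i]) :
  (forall k : R[i], 0 <= k * k^* * A + k^* * B + k * C) -> B = 0.
Proof.
case: A B C => [a1 a2] [b1 b2] [c1 c2] h.
have hr (x : R) : (x ^+ 2 * a2 + x * (b2 + c2) == 0) &&
    (0 <= x ^+ 2 * a1 + x * (b1 + c1)).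
  have := h (x +i* 0); rewrite -[(_ +i* _)^*]/(_ +i* _); simpc.
  move=> /andP[/eqP h1 h2]; apply/andP; split.
    by rewrite -h1; apply/eqP; ring.
  by rewrite (le_trans h2)// le_eqVlt; apply/orP; left; apply/eqP; ring.
have hi (x : R) : (x ^+ 2 * a2 + x * (c1 - b1) == 0) &&
    (0 <= x ^+ 2 * a1 + x * (b2 - c2)).
  have := h (0 +i* x); rewrite -[(_ +i* _)^*]/(_ +i* _); simpc.
  move=> /andP[/eqP h1 h2]; apply/andP; split.
    by rewrite -h1; apply/eqP; ring.
  by rewrite (le_trans h2)// le_eqVlt; apply/orP; left; apply/eqP; ring.
have r1 := quadratic_ge0_eq0 (fun x => (andP (hr x)).2).
have r2 := quadratic_ge0_eq0 (fun x => (andP (hi x)).2).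
have /andP[/eqP + _] := hr 1; have /andP[/eqP + _] := hr (-1).
have /andP[/eqP + _] := hi 1; have /andP[/eqP + _] := hi (-1).
rewrite !sqrrN !expr1n !mul1r !mulN1r => e1 e2 e3 e4.
by apply/eqP; rewrite eq_complex /=; apply/andP; split; apply/eqP; lra.
Qed.

Section KMSState.
Variables (R : realType) (sigma : R -> toeplitz R -> toeplitz R).
Variables (beta : R) (phi : toeplitz R -> R[i]^o).
Hypothesis dyn : is_dynamics sigma.
Hypothesis kms : is_KMS sigma beta phi.
Local Notation T := (toeplitz R).
Implicit Types (a b c q x y : T) (k : R[i]) (l m t : R).

Lemma phi_linear k a b : phi (k *: a + b) = k * phi a + phi b.
Proof. by have [[lin _ _] _] := kms; rewrite lin. Qed.

Lemma phi0 : phi 0 = 0.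
Proof.
by rewrite -[0 in LHS](subrr 0) -scaleN1r addrC phi_linear mulN1r addNr.
Qed.

Lemma phiZ k a : phi (k *: a) = k * phi a.
Proof. by rewrite -[k *: a]addr0 phi_linear phi0 addr0. Qed.

Lemma phiD a b : phi (a + b) = phi a + phi b.
Proof. by rewrite -{1}[a]scale1r phi_linear mul1r. Qed.

Lemma phiB a b : phi (a - b) = phi a - phi b.
Proof. by rewrite phiD -scaleN1r phiZ mulN1r. Qed.

Lemma phi_le a : `|phi a| <= `|a|.
Proof.
have [[_ _ phi1] _] := kms.
have [->|a0] := eqVneq a 0; first by rewrite phi0 !normr0.
have na : 0 < `|a| by rewrite normr_gt0.
set B : set R := [set Normc.normc `|phi x| | x in [set x | `|x| <= 1]].
have hB : has_sup B.
  apply: contrapT => nB; have := sup_out nB.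
  by move: phi1; rewrite /opnorm -/B => -> /eqP; rewrite oner_eq0.
have aB : B (Normc.normc `|phi (`|a|^-1 *: a)|).
  by exists (`|a|^-1 *: a) => //=; rewrite normfZV.
have := ub_le_sup hB.2 aB; rewrite -/(opnorm phi) phi1.
rewrite phiZ normrM normfV normr_id -lecR.
have -> : (Normc.normc (`|a|^-1 * `|phi a|))%:C = `|a|^-1 * `|phi a|.
  by apply: ger0_norm; rewrite mulr_ge0// invr_ge0.
by rewrite ler_pdivrMl// mulr1.
Qed.

(** At z = i beta the entire extension of the orbit of a has the factor exp(i l * i beta) = exp(-l
    beta). *)
Lemma KMS_homogeneous l m a b : homogeneous sigma l a -> homogeneous sigma m b ->
  phi (a * b) = (expR (- (l * beta)))%:C * phi (b * a).
Proof.
move=> ha hb; have [_ kmsE] := kms.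
have := homogeneous_extension ha; set F := (X in entire_extension _ _ X) => aF.
have bF : analytic sigma b.
  by eexists; exact: homogeneous_extension hb.
rewrite (kmsE _ _ _ bF aF) /F toeplitz_scalerAr phiZ; congr (_ * _).
rewrite /cexp; simpc; rewrite sin0 cos0 mulr1 mulr0 //.
Qed.

Lemma KMS_projection_mul0 q x : adjointable q -> star q = q -> q * q = q ->
  phi q = 0 -> adjointable x -> phi (x * q) = 0.
Proof.
move=> qq sq q2 q0 xx; have [[_ pos _] _] := kms.
have [sxx ssx] := adjointable_star xx.
apply: (@hermitian_ge0_eq0 R (phi (x * star x)) _ (phi (q * star x))) => k.
(* Cauchy-Schwarz: positivity along the line k x^* + q. *)
have := pos (k *: star x + q).
have [_ ->] := adjointable_linear k sxx qq; rewrite ssx sq.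
rewrite mulrDl !mulrDr q2 !toeplitz_scalerAl !toeplitz_scalerAr.
by rewrite !phiD !phiZ q0 addr0 mulrA [k^* * k]mulrC.
Qed.

Lemma KMS_projection_homogeneous q l m x y :
  homogeneous sigma 0 q -> star q = q -> q * q = q -> phi q = 0 ->
  homogeneous sigma l x -> homogeneous sigma m y -> phi (x * q * y) = 0.
Proof.
move=> hq sq q2 q0 hx hy.
rewrite (KMS_homogeneous (homogeneous_mul dyn hx hq) hy) mulrA.
rewrite (KMS_projection_mul0 hq.1 sq q2 q0) ?mulr0//.
exact: (adjointable_mul hy.1 hx.1).1.
Qed.

(** Stated for one variable, so that in [KMS_projection] the restriction to eigenvectors is lifted
    from x and y in turn. *)
Lemma bounded_homogeneous0 (f : T -> R[i]) (M : R[i]) : 0 <= M ->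
  (forall k a b, f (k *: a + b) = k * f a + f b) ->
  (forall a, `|f a| <= M * `|a|) ->
  (forall l a, homogeneous sigma l a -> f a = 0) -> forall a, f a = 0.
Proof.
move=> M0 lin fM f0 a.
have fspan b : homogeneous_span sigma b -> f b = 0.
  elim=> [|k l c d hc _ IH]; last by rewrite lin IH (f0 _ _ hc) mulr0 addr0.
  exact/f0/(homogeneous0 dyn 0).
apply/normr0_eq0/eqP; rewrite eq_le normr_ge0 andbT; apply/ler_addgt0Pl => e e0.
have M1 : 0 < M + 1 by rewrite ltr_wpDl.
have [b sb ab] := homogeneous_span_dense dyn a (divr_gt0 e0 M1).
rewrite addr0.
have -> : f a = f (a - b).
  by rewrite addrC -scaleN1r lin (fspan _ sb) mulr0 add0r.
apply: le_trans (fM _) _; apply: (@le_trans _ _ ((M + 1) * `|a - b|)).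
  by rewrite ler_wpM2r// lerDl.
by rewrite mulrC -ler_pdivlMr// ltW.
Qed.

Lemma KMS_projection q x y :
  homogeneous sigma 0 q -> star q = q -> q * q = q -> phi q = 0 ->
  phi (x * q * y) = 0.
Proof.
move=> hq sq q2 q0.
apply: (@bounded_homogeneous0 (fun x => phi (x * q * y)) (`|q| * `|y|)).
- by rewrite mulr_ge0.
- by move=> k a b; rewrite !mulrDl !toeplitz_scalerAl phi_linear.
- move=> a; apply: le_trans (phi_le _) _.
  rewrite mulrC; apply: le_trans (toeplitz_norm_mul _ _) _.
  by rewrite mulrA ler_wpM2r// toeplitz_norm_mul.
move=> l a ha.
apply: (@bounded_homogeneous0 (fun y => phi (a * q * y)) `|a * q|) => //.
- by move=> k b c; rewrite mulrDr toeplitz_scalerAr phi_linear.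
- by move=> b; apply: le_trans (phi_le _) (toeplitz_norm_mul _ _).
by move=> m b hb; exact: KMS_projection_homogeneous ha hb.
Qed.

(** The elements a with phi (x a y) = 0 for all x and y form a closed two-sided ideal, which the
    kernel of phi alone need not be; x = y = 1 gives back phi a = 0. *)
Lemma vanishes_on_ideal (X : set T) :
  (forall q x y, X q -> phi (x * q * y) = 0) ->
  vanishes_on phi (ideal_generated X).
Proof.
move=> X0 a; pose I : set T := [set a | forall x y, phi (x * a * y) = 0].
have idI : closed_ideal I.
  split.
  - move=> b Ib x y.
    have M1 : 0 < `|x| * `|y| + 1 by rewrite ltr_wpDl// mulr_ge0.
    apply/normr0_eq0/eqP; rewrite eq_le normr_ge0 andbT.
    apply/ler_addgt0Pl => e e0; rewrite addr0.
    have [c Ic bc] := (closure_normP _ _).1 Ib _ (divr_gt0 e0 M1).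
    have -> : phi (x * b * y) = phi (x * (b - c) * y).
      by rewrite mulrBr mulrBl phiB Ic subr0.
    apply: le_trans (phi_le _) _; apply: le_trans (toeplitz_norm_mul _ _) _.
    apply: (@le_trans _ _ ((`|x| * `|y| + 1) * `|b - c|)).
      apply: (@le_trans _ _ (`|x| * `|y| * `|b - c|)).
        by rewrite mulrAC ler_wpM2r// toeplitz_norm_mul.
      by rewrite ler_wpM2r// lerDl.
    by rewrite mulrC -ler_pdivlMr// ltW.
  - by move=> x y; rewrite mulr0 mul0r phi0.
  - move=> k b c Ib Ic x y.
    rewrite mulrDr mulrDl toeplitz_scalerAr toeplitz_scalerAl phi_linear.
    by rewrite Ib Ic mulr0 addr0.
  - by move=> b c Ic x y; rewrite mulrA; exact: Ic.
  - by move=> b c Ic x y; rewrite mulrA -mulrA; exact: Ic.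
move=> /(_ I) aI; rewrite -[a]mul1r -[1 * a]mulr1; apply: aI; split => // q Xq x y.
exact: X0.
Qed.

(** Common form of both kinds of generators: a single z = (1, 1) for [s_defect], and z_j = (j, p)
    with j < p for [v_defect]. *)
Definition range_defect n (z : 'I_n -> affsg) : T :=
  1 - \sum_(i < n) Tgen R (z i) * star (Tgen R (z i)).

Lemma KMS_range_defect n (z : 'I_n -> affsg) :
  (forall i j u v, i != j -> affmul (z i) u <> affmul (z j) v) ->
  \sum_(i < n) expR (- (ln (val (z i).2)%:R * beta)) = 1 ->
  forall x y, phi (x * range_defect z * y) = 0.
Proof.
move=> disj sum1 x y; rewrite /range_defect.
pose P i := Tgen R (z i) * star (Tgen R (z i)).
set S := (X in 1 - X).
have TT i := (Tgen_star R (z i)).1.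
have hP i : homogeneous sigma 0 (P i).
  rewrite -(subrr (ln (val (z i).2)%:R)); apply: homogeneous_mul => //.
    exact: homogeneous_Tgen.
  by apply: homogeneous_star => //; exact: homogeneous_Tgen.
have sP i : star (P i) = P i.
  have [tt1 tt2] := adjointable_star (TT i).
  by rewrite /P (adjointable_mul (TT i) tt1).2 tt2.
have PP i j : P i * P j = if i == j then P i else 0.
  rewrite /P mulrA -[_ * _ * Tgen R (z j)]mulrA.
  have [<-|ij] := eqVneq i j; first by rewrite star_Tgen_mul mulr1.
  (* Disjoint right ideals z_i S and z_j S give orthogonal ranges. *)
  by rewrite star_Tgen_mul0 ?mulr0 ?mul0r// => u v; exact: disj.
have [hS sS] : homogeneous sigma 0 S /\ star S = S.
  rewrite /S; apply: (big_ind (fun a => homogeneous sigma 0 a /\ star a = a)).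
  - by split; [exact: homogeneous0|exact: (adjointable0 R).2].
  - move=> a b [ha sa] [hb sb]; rewrite -[a]scale1r; split.
      exact: homogeneous_linear.
    by rewrite (adjointable_linear 1 ha.1 hb.1).2 sa sb rmorph1 !scale1r.
  - by move=> i _; split; [exact: hP|exact: sP].
have SS : S * S = S.
  rewrite /S mulr_suml; apply: eq_bigr => i _; rewrite mulr_sumr.
  rewrite (bigD1 i)//= PP eqxx big1 ?addr0// => j ji.
  by rewrite PP eq_sym (negbTE ji).
have h1 := homogeneous1 dyn; have s1 := (adjointable1 R).2.
apply: KMS_projection.
- by rewrite addrC -scaleN1r; exact: homogeneous_linear.
- rewrite addrC -scaleN1r (adjointable_linear (-1) hS.1 h1.1).2.
  by rewrite sS s1 rmorphN1.
- by rewrite mulrBr mulrBl mulr1 mul1r mulrBl mul1r SS subrr subr0.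
rewrite phiB; apply/eqP; rewrite subr_eq0; apply/eqP.
have phi_sum : phi S = \sum_(i < n) phi (P i).
  exact: (big_morph phi phiD phi0).
rewrite phi_sum (eq_bigr (fun i =>
    (expR (- (ln (val (z i).2)%:R * beta)))%:C * phi 1)); last first.
  move=> i _; have hT := homogeneous_Tgen dyn (z i).
  by rewrite (KMS_homogeneous hT (homogeneous_star dyn hT)) star_Tgen_mul.
by rewrite -mulr_suml -rmorph_sum sum1 mul1r.
Qed.

End KMSState.

(** * The two kinds of generators as range defects *)

Lemma adjointable_exp (R : realType) (a : toeplitz R) n : adjointable a ->
  adjointable (a ^+ n) /\ star (a ^+ n) = star a ^+ n.
Proof.
move=> aa; elim: n => [|n [IH1 IH2]]; first by rewrite !expr0; exact: adjointable1.
have [h1 h2] := adjointable_mul aa IH1.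
by rewrite exprS exprSr h2 IH2.
Qed.

Lemma s_defectE (R : realType) :
  s_defect R = range_defect R (fun _ : 'I_1 => (1%N, posnat_one)).
Proof. by rewrite /range_defect big_ord1. Qed.

Lemma v_defectE (R : realType) (p : posnat) :
  v_defect R p = range_defect R (fun j : 'I_(val p) => (j : nat, p)).
Proof.
congr (1 - _); apply: eq_bigr => j _.
have aS := adjointable_exp j (Tgen_star R (1%N, posnat_one)).1.
rewrite Tgen_split /= (adjointable_mul aS.1 (Tgen_star R (0%N, p)).1).2.
by rewrite aS.2 !mulrA.
Qed.

Theorem lemma10p4 (R : realType) (sigma : R -> toeplitz R -> toeplitz R)
    (beta : R) (phi : toeplitz R -> R[i]^o) :
  is_dynamics sigma -> 1 <= beta -> is_KMS sigma beta phi ->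
  vanishes_on phi (ideal_generated [set s_defect R]) /\
  (beta = 1 ->
   vanishes_on phi
     (ideal_generated [set v_defect R p | p in [set p : posnat | prime (val p)]])).
Proof.
move=> dyn _ kms; split=> [|beta1]; apply: (vanishes_on_ideal kms).
  move=> _ x y ->; rewrite s_defectE; apply: (KMS_range_defect dyn kms).
    by move=> i j; rewrite !ord1 eqxx.
  by rewrite big_ord1 /= ln1 mul0r oppr0 expR0.
move=> _ x y [p _ <-]; rewrite v_defectE; apply: (KMS_range_defect dyn kms).
  (* First coordinates in the right ideal of (j, p) have the form j + p n; reduction modulo p
     recovers j because j < p. *)
  move=> i j [n b] [n' b'] /= ij [/(congr1 (modn^~ (val p))) + _].
  rewrite ![(_ + val p * _)%N]addnC ![(val p * _)%N]mulnC !modnMDl.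
  by rewrite !modn_small//; move/eqP: ij => ij /val_inj.
have p0 : 0 < (val p)%:R :> R by rewrite ltr0n (valP p).
(* At beta = 1 each of the p weights p^{-beta} is 1/p, so they sum to 1. *)
rewrite (eq_bigr (fun=> (val p)%:R^-1)) => [|j _].
  by rewrite sumr_const card_ord -[LHS]mulr_natr mulVf// gt_eqF.
by rewrite /= beta1 mulr1 expRN lnK ?posrE.
Qed.
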